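(* Let $f:A\rightarrow B$ and $g:A\rightarrow C$ be two ring homomorphisms and let $J$ and $J'$ be ideals of $B$ and $C$, respectively, such that $f^{-1}(J)=g^{-1}(J')$. If $J\subseteq \mathrm{Im}(f)$, $J'\subseteq \mathrm{Im}(g)$, and $\mathrm{Ker}(f)$ and $\mathrm{Ker}(g)$ are nil ideals of $A$, then the ring $A\bowtie^{f,g}(J,J')$ is Nil$_{\ast}$-Noetherian if and only if the rings $f(A)$ and $g(A)$ are Nil$_{\ast}$-Noetherian.
   Context: All rings are commutative with identity. An ideal $I$ of a ring $R$ is a nil ideal if every element of $I$ is nilpotent. A ring $R$ is Nil$_{\ast}$-Noetherian if every nil ideal of $R$ is finitely generated. For ring homomorphisms $f:A\to B$, $g:A\to C$ and ideals $J$ of $B$ and $J'$ of $C$ with $f^{-1}(J)=g^{-1}(J')$, the bi-amalgamated algebra of $A$ with $(B,C)$ along $(J,J')$ with respect to $(f,g)$ is the subring of $B\times C$ given by $A\bowtie^{f,g}(J,J'):=\{(f(a)+j,\,g(a)+j')\mid a\in A,\ (j,j')\in J\times J'\}$. *)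

(* Defs.v *)
From HB Require Import structures.
From mathcomp Require Import all_boot all_algebra.
From mathcomp Require Import boolp classical_sets.

Set Implicit Arguments.
Unset Strict Implicit.
Unset Printing Implicit Defensive.

Import GRing.Theory.

Local Open Scope classical_set_scope.
Local Open Scope ring_scope.

(* Rings are [comPzRingType]: the zero ring is allowed.  The ideals of
   [ring_quotient] are proper and live in nontrivial rings, whereas the ideals
   below may be the whole ring. *)
Record ideal (R : comPzRingType) := Ideal {
  ideal_set :> set R;
  ideal0 : ideal_set 0;
  idealD : forall x y, ideal_set x -> ideal_set y -> ideal_set (x + y);
  idealM : forall a x, ideal_set x -> ideal_set (a * x) }.

Definition nil_ideal (R : comPzRingType) (I : ideal R) : Prop :=
  I `<=` [set x | exists n, x ^+ n = 0].

Definition finitely_generated (R : comPzRingType) (I : ideal R) : Prop :=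
  exists (n : nat) (s : 'I_n -> R),
    I = [set x | exists c : 'I_n -> R, x = \sum_(i < n) c i * s i] :> set R.

Definition nil_noetherian (R : comPzRingType) : Prop :=
  forall I : ideal R, nil_ideal I -> finitely_generated I.

Section Kernel.
Variables (A B : comPzRingType) (f : {rmorphism A -> B}).

Let ker_set : set A := [set x | f x = 0].

Fact ker_ideal0 : ker_set 0.
Proof. exact: rmorph0. Qed.

Fact ker_idealD x y : ker_set x -> ker_set y -> ker_set (x + y).
Proof. by rewrite /ker_set /= rmorphD => -> ->; rewrite addr0. Qed.

Fact ker_idealM a x : ker_set x -> ker_set (a * x).
Proof. by rewrite /ker_set /= rmorphM => ->; rewrite mulr0. Qed.

Definition ker_ideal : ideal A := Ideal ker_ideal0 ker_idealD ker_idealM.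

End Kernel.

(* The ring carried by a subring [S] of [R], with the operations of [R]. *)
Record subring_type (R : comPzRingType) (S : subringClosed R) := SubringType {
  subring_val : R;
  _ : subring_val \in S }.

Section SubringType.
Variables (R : comPzRingType) (S : subringClosed R).
HB.instance Definition _ := [isSub for @subring_val R S].
HB.instance Definition _ := [Choice of subring_type S by <:].
HB.instance Definition _ :=
  GRing.SubChoice_isSubComPzRing.Build R (mem S) (subring_type S)
    (GRing.subringClosedP S).
End SubringType.

Section ImageRing.
Variables (A B : comPzRingType) (f : {rmorphism A -> B}).

Definition image_pred : {pred B} := [pred y | y \in range f].

Fact image_pred_subring_closed : subring_closed image_pred.
Proof.
split=> [|x y|x y]; rewrite !inE.
- by exists 1; rewrite ?rmorph1.
- by move=> [a _ <-] [b _ <-]; exists (a - b); rewrite ?rmorphB.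
- by move=> [a _ <-] [b _ <-]; exists (a * b); rewrite ?rmorphM.
Qed.

HB.instance Definition _ :=
  GRing.isSubringClosed.Build B image_pred image_pred_subring_closed.

Definition image_ring : comPzRingType := subring_type image_pred.

End ImageRing.

Section BiAmalgamation.
Variables (A B C : comPzRingType).
Variables (f : {rmorphism A -> B}) (g : {rmorphism A -> C}).
Variables (J : ideal B) (J' : ideal C).

Definition bi_amalg_set : set (B * C) :=
  [set z | exists a j j', [/\ ideal_set J j, ideal_set J' j' & z = (f a + j, g a + j')]].

Definition bi_amalg_pred : {pred B * C} := [pred z | z \in bi_amalg_set].

Fact bi_amalg_pred_subring_closed : subring_closed bi_amalg_pred.
Proof.
have idealN (R : comPzRingType) (I : ideal R) x : ideal_set I x -> ideal_set I (- x).
  by rewrite -mulN1r; exact: idealM.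
have mulE (R : comPzRingType) (u v i k : R) :
    (u + i) * (v + k) = u * v + (u * k + (v + k) * i).
  by rewrite mulrDl mulrDr (mulrC i) addrA.
split=> [|x y|x y]; rewrite !inE.
- by exists 1, 0, 0; split; rewrite ?rmorph1 ?addr0 //; exact: ideal0.
- move=> [a [j [j' [Jj Jj' ->]]]] [b [k [k' [Jk Jk' ->]]]].
  exists (a - b), (j - k), (j' - k'); split.
  + by apply: idealD => //; exact: idealN.
  + by apply: idealD => //; exact: idealN.
  + by congr pair; rewrite rmorphB /= opprD addrACA.
- move=> [a [j [j' [Jj Jj' ->]]]] [b [k [k' [Jk Jk' ->]]]].
  exists (a * b), (f a * k + (f b + k) * j), (g a * k' + (g b + k') * j').
  split; [by apply: idealD; exact: idealM..|].
  by congr pair; rewrite rmorphM /= -mulE.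
Qed.

HB.instance Definition _ :=
  GRing.isSubringClosed.Build (B * C)%type bi_amalg_pred
    bi_amalg_pred_subring_closed.

(* The bi-amalgamated algebra, as a subring of [B * C].  This is a subring
   whether or not the preimages of [J] and [J'] agree. *)
Definition bi_amalg : comPzRingType := subring_type bi_amalg_pred.

End BiAmalgamation.

(* Main.v *)
Require Import Defs.
From HB Require Import structures.
From mathcomp Require Import all_boot all_algebra.
From mathcomp Require Import boolp classical_sets.

(** Let [R] be the bi-amalgamation.  Since [J] and [J'] lie in the images of
    [f] and [g], the two coordinates map [R] into [f(A)] and [g(A)].  They are
    onto, because [R] contains the diagonal pairs [(f a, g a)], and jointly
    injective, because [R] is a subring of [B * C].

    If [f(A)] and [g(A)] are Nil-star-Noetherian and [I] is a nil ideal of [R],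
    then [I] is an extension of its image in [f(A)] by the part of [I] killed
    by the first coordinate, and that part embeds in [g(A)] as a nil ideal.
    Both pieces are finitely generated, hence so is [I]: finite generation
    passes to extensions ([finitely_generated_extension]), and the argument
    works for any ring with two jointly injective surjections
    ([nil_noetherian_joint_inj]).

    Conversely, Nil-star-Noetherianity does not descend along arbitrary
    surjections, because the preimage of a nil ideal need not be nil.  It does
    descend when nilpotent elements lift to nilpotent elements
    ([nil_noetherian_lift]).  Here they lift: if [f a] is nilpotent, then a
    power of [a] lies in the nil ideal [Ker f], so [a] is nilpotent, and
    [(f a, g a)] is a nilpotent element of [R] over [f a]. *)

Set Implicit Arguments.
Unset Strict Implicit.
Unset Printing Implicit Defensive.

Import GRing.Theory.

Local Open Scope classical_set_scope.
Local Open Scope ring_scope.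

(** * Nilpotent elements *)

Definition nilpotent_elt (R : comPzRingType) (x : R) := exists n, x ^+ n = 0.

Lemma nilpotent_eltD (R : comPzRingType) (x y : R) :
  nilpotent_elt x -> nilpotent_elt y -> nilpotent_elt (x + y).
Proof.
move=> [m xm0] [n yn0]; exists (m + n)%N.
rewrite exprDn big1 // => i _.
(* In each term x ^ (m + n - i) * y ^ i, either n <= i or m <= m + n - i. *)
have [ni|/ltnW iltn] := leqP n i.
  by rewrite -(subnK ni) exprD yn0 !mulr0 mul0rn.
by rewrite -addnBA // exprD xm0 !mul0r mul0rn.
Qed.

Lemma nilpotent_eltM (R : comPzRingType) (a x : R) :
  nilpotent_elt x -> nilpotent_elt (a * x).
Proof. by move=> [n xn0]; exists n; rewrite exprMn xn0 mulr0. Qed.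

Lemma nilpotent_elt_rmorph (R S : comPzRingType) (p : {rmorphism R -> S}) x :
  nilpotent_elt x -> nilpotent_elt (p x).
Proof. by move=> [n xn0]; exists n; rewrite -rmorphXn xn0 rmorph0. Qed.

(** * Finite generation of ideals *)

Section Ideals.
Variable R : comPzRingType.

Lemma idealB (I : ideal R) x y :
  ideal_set I x -> ideal_set I y -> ideal_set I (x - y).
Proof. by move=> Ix Iy; apply: idealD => //; rewrite -mulN1r; apply: idealM. Qed.

Lemma ideal_lin_comb (I : ideal R) n (c s : 'I_n -> R) :
  (forall i, ideal_set I (s i)) -> ideal_set I (\sum_(i < n) c i * s i).
Proof.
move=> Is; apply: (big_ind (ideal_set I)) => [|x y|i _].
- exact: ideal0.
- exact: idealD.
- exact: idealM.
Qed.

(** Splits an equality of sets into the two facts that the proofs below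
    establish separately: membership of the generators, which makes every
    combination of them a member, and decomposition of the members. *)
Lemma finitely_generatedP (I : ideal R) :
  finitely_generated I <->
  exists n (s : 'I_n -> R), (forall i, ideal_set I (s i)) /\
    forall x, ideal_set I x -> exists c : 'I_n -> R, x = \sum_(i < n) c i * s i.
Proof.
split=> [[n [s Is]]|[n [s [Is Ic]]]]; exists n, s.
- split=> [i|x]; rewrite Is //=.
  exists (fun k => (k == i)%:R); rewrite (bigD1 i) //= eqxx mul1r big1 ?addr0//.
  by move=> k /negPf ->; rewrite mul0r.
- by apply/seteqP; split=> [x /Ic //|x [c ->]]; apply: ideal_lin_comb.
Qed.

Lemma idealI0 (I K : ideal R) : (I `&` K) 0.
Proof. by split; apply: ideal0. Qed.

Lemma idealID (I K : ideal R) x y :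
  (I `&` K) x -> (I `&` K) y -> (I `&` K) (x + y).
Proof. by move=> [? ?] [? ?]; split; apply: idealD. Qed.

Lemma idealIM (I K : ideal R) a x : (I `&` K) x -> (I `&` K) (a * x).
Proof. by move=> [? ?]; split; apply: idealM. Qed.

Definition idealI (I K : ideal R) : ideal R :=
  Ideal (idealI0 I K) (@idealID I K) (@idealIM I K).

Definition nilradical : ideal R :=
  @Ideal R (@nilpotent_elt R) (ex_intro _ 1%N (expr1 0))
    (@nilpotent_eltD R) (@nilpotent_eltM R).

End Ideals.

(** * Ideals along a surjective morphism *)

Section Surjection.
Variables (R S : comPzRingType) (p : {rmorphism R -> S}).

Lemma preimage_ideal0 (I : ideal S) : (p @^-1` I) 0.
Proof. by rewrite /preimage /= rmorph0; apply: ideal0. Qed.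

Lemma preimage_idealD (I : ideal S) x y :
  (p @^-1` I) x -> (p @^-1` I) y -> (p @^-1` I) (x + y).
Proof. by rewrite /preimage /= rmorphD; apply: idealD. Qed.

Lemma preimage_idealM (I : ideal S) a x :
  (p @^-1` I) x -> (p @^-1` I) (a * x).
Proof. by rewrite /preimage /= rmorphM; apply: idealM. Qed.

Definition preimage_ideal (I : ideal S) : ideal R :=
  Ideal (preimage_ideal0 I) (@preimage_idealD I) (@preimage_idealM I).

Hypothesis p_surj : forall y, exists x, p x = y.

Lemma image_ideal0 (I : ideal R) : (p @` I) 0.
Proof. by exists 0; [apply: ideal0|rewrite rmorph0]. Qed.

Lemma image_idealD (I : ideal R) x y :
  (p @` I) x -> (p @` I) y -> (p @` I) (x + y).
Proof.
by move=> [u Iu <-] [v Iv <-]; exists (u + v); [apply: idealD|rewrite rmorphD].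
Qed.

Lemma image_idealM (I : ideal R) a x : (p @` I) x -> (p @` I) (a * x).
Proof.
have [b <-] := p_surj a.
by move=> [u Iu <-]; exists (b * u); [apply: idealM|rewrite rmorphM].
Qed.

Definition image_ideal (I : ideal R) : ideal S :=
  Ideal (image_ideal0 I) (@image_idealD I) (@image_idealM I).

Lemma nil_image_ideal (I : ideal R) : nil_ideal I -> nil_ideal (image_ideal I).
Proof. by move=> nilI _ [x /nilI nx <-]; apply: nilpotent_elt_rmorph. Qed.

Lemma finitely_generated_image (I : ideal R) :
  finitely_generated I -> finitely_generated (image_ideal I).
Proof.
move=> /finitely_generatedP [n [s [Is Ic]]].
apply/finitely_generatedP; exists n, (p \o s); split=> [i|_ [x /Ic [c ->] <-]].
  by exists (s i).
exists (p \o c); rewrite rmorph_sum; apply: eq_bigr => i _.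
by rewrite rmorphM.
Qed.

(** As for modules in a short exact sequence: lifts in [I] of generators of
    [p(I)], together with generators of the kernel part, generate [I]. *)
Lemma finitely_generated_extension (I : ideal R) :
  finitely_generated (image_ideal I) ->
  finitely_generated (idealI I (ker_ideal p)) ->
  finitely_generated I.
Proof.
move=> /finitely_generatedP [n [s [Is Sc]]].
move=> /finitely_generatedP [m [t [It Tc]]].
have [r Ir pr] :
    exists2 r, forall i, ideal_set I (r i) & forall i, p (r i) = s i.
  have /choice [r Hr] : forall i, exists x, ideal_set I x /\ p x = s i.
    by move=> i; have [x Ix px] := Is i; exists x.
  by exists r => i; have [] := Hr i.
apply/finitely_generatedP; exists (n + m)%N.
exists (fun k => match split k with inl i => r i | inr j => t j end).
split=> [k|x Ix]; first by case: (split k) => // j; case: (It j).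
have [c px] : exists c, p x = \sum_(i < n) c i * s i.
  by apply: Sc; exists x.
have /choice [b pb] : forall i, exists u, p u = c i by [].
(* Subtracting the combination of the lifts moves x into the kernel. *)
have [d xd] : exists d, x - \sum_(i < n) b i * r i = \sum_(j < m) d j * t j.
  apply: Tc; split; first by apply: idealB => //; apply: ideal_lin_comb.
  rewrite /= rmorphB rmorph_sum px; apply/eqP; rewrite subr_eq0; apply/eqP.
  by apply: eq_bigr => i _; rewrite rmorphM pb pr.
exists (fun k => match split k with inl i => b i | inr j => d j end).
rewrite big_split_ord /= -(subrK (\sum_(i < n) b i * r i) x) xd addrC.
by congr (_ + _); apply: eq_bigr => i _;
  rewrite ?(unsplitK (inl _ i)) ?(unsplitK (inr _ i)).
Qed.

(** An extension with zero kernel part: the generators of the image lift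
    uniquely to [I]. *)
Lemma finitely_generated_inj_image (I : ideal R) :
  (forall x, ideal_set I x -> p x = 0 -> x = 0) ->
  finitely_generated (image_ideal I) -> finitely_generated I.
Proof.
move=> inj_p fgI; apply: finitely_generated_extension => //.
apply/finitely_generatedP; exists 0, (fun=> 0); split=> [[]//|x [Ix px0]].
by exists (fun=> 0); rewrite big_ord0; apply: inj_p.
Qed.

(** A nil ideal [I] of [S] is the image of the ideal of the nilpotent elements
    of [R] lying over it, and the latter is nil by construction. *)
Lemma nil_noetherian_lift :
  (forall y, nilpotent_elt y -> exists2 x, nilpotent_elt x & p x = y) ->
  nil_noetherian R -> nil_noetherian S.
Proof.
move=> lift nnR I nilI; pose L := idealI (preimage_ideal I) (nilradical R).
have fgL : finitely_generated L by apply: nnR => x [].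
have imL : ideal_set (image_ideal L) = ideal_set I.
  apply/seteqP; split=> [_ [x [Ix _] <-] //|y Iy].
  have [x nx xy] := lift y (nilI y Iy).
  by exists x => //; split=> //; rewrite /= xy.
by have := finitely_generated_image fgL; rewrite /finitely_generated imL.
Qed.

End Surjection.

(** A nil ideal [I] of [R] is an extension of [p(I)] by [I] intersected with
    [Ker p]; joint injectivity makes [q] injective on the latter, which is
    therefore controlled by its image, a nil ideal of [T]. *)
Lemma nil_noetherian_joint_inj (R S T : comPzRingType)
    (p : {rmorphism R -> S}) (q : {rmorphism R -> T}) :
  (forall y, exists x, p x = y) -> (forall y, exists x, q x = y) ->
  (forall x, p x = 0 -> q x = 0 -> x = 0) ->
  nil_noetherian S -> nil_noetherian T -> nil_noetherian R.
Proof.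
move=> p_surj q_surj pq_inj nnS nnT I nilI.
apply: (finitely_generated_extension (p_surj := p_surj)).
  exact/nnS/nil_image_ideal.
apply: (finitely_generated_inj_image (p_surj := q_surj)).
  by move=> x [_ px0]; apply: pq_inj.
by apply/nnT/nil_image_ideal => x [/nilI].
Qed.

(** * The coordinates of the bi-amalgamation *)

Section Corestriction.
Variables (R T : comPzRingType) (S : subringClosed T) (h : {rmorphism R -> T}).
Hypothesis hS : forall x, h x \in S.

Definition corestrict (x : R) : subring_type S := SubringType (hS x).

Fact corestrict_zmod_morphism : zmod_morphism corestrict.
Proof. by move=> x y; apply: val_inj; rewrite /= rmorphB. Qed.

Fact corestrict_monoid_morphism : monoid_morphism corestrict.
Proof.
by split=> [|x y]; apply: val_inj; rewrite /= ?rmorph1 ?rmorphM.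
Qed.

HB.instance Definition _ :=
  GRing.isZmodMorphism.Build R (subring_type S) corestrict
    corestrict_zmod_morphism.
HB.instance Definition _ :=
  GRing.isMonoidMorphism.Build R (subring_type S) corestrict
    corestrict_monoid_morphism.

End Corestriction.

Lemma image_add_range (A B : comPzRingType) (f : {rmorphism A -> B}) a y :
  range f y -> f a + y \in image_pred f.
Proof. by move=> [b _ <-]; rewrite inE; exists (a + b); rewrite ?rmorphD. Qed.

Lemma nilpotent_elt_nil_ker (A B : comPzRingType) (f : {rmorphism A -> B}) a :
  nil_ideal (ker_ideal f) -> nilpotent_elt (f a) -> nilpotent_elt a.
Proof.
move=> nilf [n fan0]; have [|m am0] := nilf (a ^+ n).
  by rewrite /= rmorphXn.
by exists (n * m)%N; rewrite exprM.
Qed.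

Section Coordinates.
Variables (A B C : comPzRingType).
Variables (f : {rmorphism A -> B}) (g : {rmorphism A -> C}).
Variables (J : ideal B) (J' : ideal C).
Hypotheses (J_im : J `<=` range f) (J'_im : J' `<=` range g).

Local Notation R := (bi_amalg f g J J').

Lemma bi_amalg_fst_image (x : R) : (fst \o val) x \in image_pred f.
Proof.
have [a [j [j' [Jj _ /= ->]]]] := set_mem (valP x).
exact/image_add_range/J_im.
Qed.

Lemma bi_amalg_snd_image (x : R) : (snd \o val) x \in image_pred g.
Proof.
have [a [j [j' [_ J'j' /= ->]]]] := set_mem (valP x).
exact/image_add_range/J'_im.
Qed.

Definition bi_amalg_fst : {rmorphism R -> image_ring f} :=
  corestrict (h := fst \o val : {rmorphism R -> B}) bi_amalg_fst_image.

Definition bi_amalg_snd : {rmorphism R -> image_ring g} :=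
  corestrict (h := snd \o val : {rmorphism R -> C}) bi_amalg_snd_image.

Fact bi_amalg_diag_subproof a : (f a, g a) \in bi_amalg_pred f g J J'.
Proof.
by rewrite inE; exists a, 0, 0; split; rewrite ?addr0 //; apply: ideal0.
Qed.

Definition bi_amalg_diag a : R := SubringType (bi_amalg_diag_subproof a).

Lemma nilpotent_bi_amalg_diag a :
  nilpotent_elt a -> nilpotent_elt (bi_amalg_diag a).
Proof.
move=> [n an0]; exists n; apply: val_inj; rewrite rmorphXn rmorph0 /=.
apply: injective_projections.
  by rewrite rmorphXn /= -rmorphXn an0 rmorph0.
by rewrite rmorphXn /= -rmorphXn an0 rmorph0.
Qed.

Lemma bi_amalg_joint_inj (x : R) :
  bi_amalg_fst x = 0 -> bi_amalg_snd x = 0 -> x = 0.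
Proof.
move=> /(congr1 val) /= x1 /(congr1 val) /= x2.
by apply: val_inj; apply: injective_projections.
Qed.

(** Diagonal lifts serve twice: they make the coordinate onto, and their
    nilpotency can be tested on [a] alone, as lifting nilpotents requires. *)
Lemma bi_amalg_fst_diag (y : image_ring f) :
  exists2 a, val y = f a & bi_amalg_fst (bi_amalg_diag a) = y.
Proof.
by have [a _ fa] := set_mem (valP y); exists a => //; apply: val_inj.
Qed.

Lemma bi_amalg_snd_diag (y : image_ring g) :
  exists2 a, val y = g a & bi_amalg_snd (bi_amalg_diag a) = y.
Proof.
by have [a _ ga] := set_mem (valP y); exists a => //; apply: val_inj.
Qed.

End Coordinates.

(** * Transfer of the Nil-star-Noetherian property *)

Unset Implicit Arguments.

Theorem theorem2p8 (A B C : comPzRingType)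
    (f : {rmorphism A -> B}) (g : {rmorphism A -> C})
    (J : ideal B) (J' : ideal C)
    (preJJ' : f @^-1` J = g @^-1` J')
    (J_im : J `<=` range f) (J'_im : J' `<=` range g)
    (ker_f_nil : nil_ideal (ker_ideal f))
    (ker_g_nil : nil_ideal (ker_ideal g)) :
  nil_noetherian (bi_amalg f g J J') <->
  nil_noetherian (image_ring f) /\ nil_noetherian (image_ring g).
Proof.
pose p := @bi_amalg_fst _ _ _ f g J J' J_im.
pose q := @bi_amalg_snd _ _ _ f g J J' J'_im.
have p_diag := @bi_amalg_fst_diag _ _ _ f g J J' J_im.
have q_diag := @bi_amalg_snd_diag _ _ _ f g J J' J'_im.
have p_surj y : exists x, p x = y by have [a _] := p_diag y; eexists; eauto.
have q_surj y : exists x, q x = y by have [a _] := q_diag y; eexists; eauto.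
split=> [nnR|[nnf nng]]; last first.
  apply: (nil_noetherian_joint_inj p_surj q_surj) => //.
  exact: bi_amalg_joint_inj.
split.
- apply: (nil_noetherian_lift p_surj) nnR => y ny.
  have [a ya pa] := p_diag y; exists (bi_amalg_diag f g J J' a) => //.
  apply/nilpotent_bi_amalg_diag/(@nilpotent_elt_nil_ker _ _ f) => //.
  by rewrite -ya; apply: nilpotent_elt_rmorph.
- apply: (nil_noetherian_lift q_surj) nnR => y ny.
  have [a ya qa] := q_diag y; exists (bi_amalg_diag f g J J' a) => //.
  apply/nilpotent_bi_amalg_diag/(@nilpotent_elt_nil_ker _ _ g) => //.
  by rewrite -ya; apply: nilpotent_elt_rmorph.
Qed.
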